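(* Let $X$ be an infinite topological space. Then $R^{*}(X) = c^{*}(\mathscr{F}[X])$, where $R^{*}(X) := \sup\{R(X^{n}) : n\in\mathbb{N}\}$ and, for a topological space $Z$, $c^{*}(Z) := \sup\{c(Z^{n}) : n\in\mathbb{N}\}$.
   Context: Here $\mathbb{N}=\{1,2,3,\dots\}$ and no separation axiom is assumed on $X$. Powers carry the product topology. Pixley-Roy hyperspace: $\mathscr{F}[X]$ is the set of all nonempty finite subsets of $X$, with the topology having as a base the sets $[F,U] := \{G : G \text{ nonempty finite subset of } X,\ F\subseteq G\subseteq U\}$, where $F$ is a nonempty finite subset of $X$ and $U$ is open in $X$. The cellularity $c(Z)$ of a space $Z$ is $\sup\{|\mathcal{U}| : \mathcal{U}$ is a pairwise disjoint family of nonempty open subsets of $Z\}+\omega$. A space $Y$ is weakly separated if there is a family $\{U_y : y\in Y\}$ of open subsets of $Y$ such that $y\in U_y$ for all $y\in Y$, and whenever $x,y\in Y$ are distinct, $x\notin U_y$ or $y\notin U_x$. The weak separation number of a space $Z$ is $R(Z) := \sup\{|Y| : Y \text{ is a weakly separated subspace of } Z\}+\omega$. *)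

(* Defs.v *)
From HB Require Import structures.
From mathcomp Require Import all_boot finmap.
From mathcomp Require Import all_classical topology function_spaces.

Set Implicit Arguments.
Unset Strict Implicit.
Unset Printing Implicit Defensive.

Local Open Scope classical_set_scope.
Local Open Scope card_scope.

(** A cardinal is represented by a type [K], of cardinal [[set: K]], and
    cardinals are compared with [#<=] and [#=].  Adding omega is taking the
    disjoint sum with [nat]. *)

Definition is_card_sup (I : Type) (F : I -> Type) (K : Type) : Prop :=
  (forall i, [set: F i] #<= [set: K]) /\
  (forall L : Type, (forall i, [set: F i] #<= [set: L]) ->
     [set: K] #<= [set: L]).

Lemma card_leTTP (T U : Type) :
  [set: T] #<= [set: U] <-> exists f : T -> U, injective f.
Proof.
split=> [/card_leP[f]|[f fI]].
  exists (fun x => val (f (to_setT x))) => x y /val_inj fxy.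
  have /(_ fxy) : f (to_setT x) = f (to_setT y) -> to_setT x = to_setT y.
    by apply: (@inj _ _ _ f); rewrite in_setT.
  by move/(congr1 val).
apply: (@card_le_trans _ _ _ (range f)); last exact: card_leT.
have /card_eqPle[] // : [set: T] #= range f.
by rewrite card_eq_sym; apply: inj_card_eq; exact: in2W.
Qed.

(* The cardinals are well-founded: a maximal set of choice functions that are
   pairwise distinct at every coordinate exhausts some coordinate. *)
Lemma card_min (J : Type) (G : J -> Type) (j0 : J) :
  exists j, forall j', [set: G j] #<= [set: G j'].
Proof.
pose P (A : set (forall j, G j)) :=
  forall f g j, A f -> A g -> f j = g j -> f = g.
have [|A [PA Amax]] := @Zorn_bigcup _ P.
  move=> C CP Ctot f g j [A CA Af] [B CB Bg].
  by have [AB|BA] := Ctot _ _ CA CB;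
    [apply: (CP _ CB) => //; exact: AB | apply: (CP _ CA) => //; exact: BA].
have [j jP] : exists j, forall x : G j, exists f, A f /\ f j = x.
  apply: contrapT => /forallNP nex.
  have H j : exists x : G j, forall g, A g -> g j <> x.
    apply: contrapT => /forallNP H; apply: (nex j) => x.
    apply: contrapT => Hx; apply: (H x) => g Ag gx; apply: Hx.
    by exists g.
  pose f j := projT1 (cid (H j)).
  have fP j g : A g -> g j <> f j by exact: (projT2 (cid (H j))).
  apply: (Amax (A `|` [set f])).
    split=> [g Ag|/(_ f)]; first by left.
    by move=> /(_ (or_intror erefl)) /(fP j0); apply.
  move=> g h j [Ag|->] [Ah|->] //; first exact: PA.
    by move=> gf; case: (fP j g Ag).
  by move=> fh; case: (fP j h Ah).
have [h hP] := choice jP.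
exists j => j'; apply/card_leTTP; exists (fun x => h x j') => x y hxy.
have [[Ax <-] [Ay <-]] := (hP x, hP y).
by rewrite (PA _ _ j' Ax Ay hxy).
Qed.

Lemma is_card_sup_ex (I : Type) (F : I -> Type) : exists K, is_card_sup F K.
Proof.
elim/Pchoice: I => I in F *.
pose ub (K : Type) := forall i, [set: F i] #<= [set: K].
pose S := {i : I & F i}.
have ubS : ub S.
  move=> i; apply/card_leTTP; exists (Tagged F) => x y.
  by move=> /(congr1 (tagged_as (Tagged F x))); rewrite !tagged_asE.
have ub_le (K L : Type) : ub K -> [set: K] #<= [set: L] -> ub L.
  by move=> ubK KL i; exact: card_le_trans (ubK i) KL.
have ubT : ub [set: S].
  apply: ub_le ubS _; apply/card_leTTP.
  by exists (@to_setT S) => x y /(congr1 val).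
have [[K /= ubK] Kmin] :=
  @card_min {A : set S | ub A} (fun A => sval A) (exist _ [set: S] ubT).
exists K; split=> // L ubL.
have [LS|SL] : [set: L] #<= [set: S] \/ [set: S] #<= [set: L].
  have [[] bmin] := @card_min bool (fun b => if b then L else S) true.
  - by left; exact: bmin false.
  - by right; exact: bmin true.
- have /card_leTTP[f fI] := LS.
  have fL : [set: set_type (range f)] #= [set: L].
    apply: card_eq_trans (card_setT (range f)) _.
    by apply: inj_card_eq; exact: in2W.
  have ubf : ub (range f).
    by apply: ub_le ubL _; have /card_eqPle[] := fL.
  apply: card_le_trans (Kmin (exist _ (range f) ubf)) _ => /=.
  by have /card_eqPle[] := fL.
- apply: card_le_trans SL; apply/card_leTTP.
  by exists val; exact: val_inj.
Qed.

Definition card_sup (I : Type) (F : I -> Type) : Type :=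
  projT1 (cid (is_card_sup_ex F)).

Lemma card_supP (I : Type) (F : I -> Type) : is_card_sup F (card_sup F).
Proof. exact: projT2 (cid (is_card_sup_ex F)). Qed.

Definition weakly_separated (Y : topologicalType) : Prop :=
  exists U : Y -> set Y,
    (forall y, open (U y) /\ U y y) /\
    (forall x y, x <> y -> ~ U y x \/ ~ U x y).

(* Subsets [Y : set Z] coerce to types; these carry the subspace topology. *)
Definition weak_separation_number (Z : topologicalType) : Type :=
  card_sup (fun Y : {Y : set Z | weakly_separated Y} => set_type (sval Y)) + nat.

Definition cellular (Z : topologicalType) (W : set (set Z)) : Prop :=
  (forall U, W U -> open U /\ U !=set0) /\ trivIset W id.

Definition cellularity (Z : topologicalType) : Type :=
  card_sup (fun W : {W : set (set Z) | cellular W} => set_type (sval W)) + nat.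

(* The index [n : nat] stands for the exponent [n.+1], so exponents start
   at 1. *)
Definition weak_separation_number_star (X : topologicalType) : Type :=
  card_sup (fun n => weak_separation_number {ptws 'I_n.+1 -> X}).

Definition cellularity_star (Z : topologicalType) : Type :=
  card_sup (fun n => cellularity {ptws 'I_n.+1 -> Z}).

Definition pixley_roy (X : choiceType) : Type := {F : {fset X} | F != fset0}.

HB.instance Definition _ (X : choiceType) := Choice.on (pixley_roy X).

Section PixleyRoy.
Context (X : topologicalType).

Definition pr_index : set ({fset X} * set X) :=
  [set FU | FU.1 != fset0 /\ open FU.2].

Definition pr_basic (FU : {fset X} * set X) : set (pixley_roy X) :=
  [set G | (FU.1 `<=` val G)%fset /\ [set` val G] `<=` FU.2].

Lemma pr_basic_cover : \bigcup_(FU in pr_index) pr_basic FU = setT.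
Proof.
apply/seteqP; split=> // G _; exists (val G, setT); last by split.
by split; [exact: (valP G) | exact: openT].
Qed.

Lemma pr_basic_join i j t : pr_index i -> pr_index j ->
  pr_basic i t -> pr_basic j t ->
  exists k, [/\ pr_index k, pr_basic k t & pr_basic k `<=` pr_basic i `&` pr_basic j].
Proof.
move=> [i0 iO] [j0 jO] [it ti] [jt tj].
exists ((i.1 `|` j.1)%fset, i.2 `&` j.2); split.
- split; last exact: openI.
  by apply: contra i0 => /eqP ij0; rewrite -fsubset0 -ij0 fsubsetUl.
- by split=> [|x tx]; [rewrite fsubUset it jt | split; [exact: ti | exact: tj]].
- move=> G [/=]; rewrite fsubUset => /andP[iG jG] GU.
  by split; split=> // x /GU[].
Qed.

HB.instance Definition _ := isBaseTopological.Build (pixley_roy X)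
  pr_basic_cover pr_basic_join.

End PixleyRoy.

(* Main.v *)
Require Import Defs.
From mathcomp Require Import all_boot finmap.
From mathcomp Require Import all_classical topology function_spaces.

Local Open Scope classical_set_scope.
Local Open Scope card_scope.

(** Both inequalities rest on one observation: two nonempty basic sets [F, U]
    and [F', U'] of the Pixley-Roy topology are disjoint exactly when F is not
    contained in U' or F' is not contained in U, because F `|` F' is otherwise
    a common element.  Disjointness in the hyperspace is thus the very
    condition that defines weak separation in X.

    If Y is weakly separated in X^n, choose for each y a box neighbourhood
    V_1 x ... x V_n whose trace on Y lies in U_y.  The products of the basic
    sets [{y_i}, V_i] are nonempty, open and pairwise disjoint in F[X]^n, so
    that R(X^n) <= c(F[X]^n) for every n ([weak_separation_number_le]).

    Conversely, shrink every member w of a cellular family of F[X]^n to a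
    product of sets [G_i, U_i] with G_i contained in U_i.  Fix k and consider
    the w for which the largest G_i has k points.  Listing each G_i, with
    repetitions, as k + 1 points makes of w a point of X^(n (k + 1)), and the
    U_i make a box around it; disjointness says that these points, for
    different w, are distinct and weakly separated by these boxes.  Hence the
    family is a countable union of pieces of size at most R*(X)
    ([cellularity_le]).  As R*(X) is infinite, R*(X) x omega <= R*(X)
    ([card_mul_nat]), and the whole family has size at most R*(X). *)

(** * Absorption of countable factors by infinite cardinals *)

(** Zorn's lemma gives a maximal set [A] of injective sequences in [L] with
    pairwise disjoint ranges.  By maximality the ranges miss only finitely many
    points, so that [L] has the cardinality of [A * nat], which absorbs one more
    factor [nat]. *)
Lemma card_mul_nat {L : Type} :
  [set: nat] #<= [set: L] -> [set: L * nat] #<= [set: L].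
Proof.
move=> /infiniteP Linf.
pose P (A : set (nat -> L)) :=
  forall f g m n, A f -> A g -> f m = g n -> f = g /\ m = n.
have [|A [PA Amax]] := @Zorn_bigcup _ P.
  move=> C CP Ctot f g m n [A CA Af] [B CB Bg].
  by have [AB|BA] := Ctot _ _ CA CB;
    [apply: (CP _ CB) => //; exact: AB | apply: (CP _ CA) => //; exact: BA].
pose C := [set x : L | exists f n, A f /\ f n = x].
have Cfin : finite_set (~` C).
  apply: contrapT => /infiniteP natC.
  have /card_leTTP[h hI] : [set: nat] #<= [set: ~` C].
    by apply: card_le_trans natC _; have /card_eqPle[] := card_setT_sym (~` C).
  (* An infinite complement would contain one more sequence [e]. *)
  pose e n := val (h n).
  have eI : injective e by move=> m n /val_inj /hI.
  have eC n : ~ C (e n) by exact: (set_mem (valP (h n))).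
  apply: (Amax (A `|` [set e])).
    split=> [g Ag|/(_ e (or_intror erefl)) Ae]; first by left.
    by apply: (eC 0); exists e, 0.
  move=> f g m n [Af|->] [Ag|->]; first exact: PA.
  - by move=> fe; case: (eC n); exists f, m.
  - by move=> eg; case: (eC m); exists g, n.
  - by move/eI.
have [a0 Aa0] : exists a, A a.
  apply: contrapT => /forallNP A0; apply: Linf.
  by apply: sub_finite_set Cfin => x _ [f [n [/A0]]].
have /countable_injP[r rI] := finite_set_countable Cfin.
pose a1 : {f | A f} := exist _ a0 Aa0.
(* Points on the sequences are sent to even positions; the finitely many others
   fit in the odd positions of the single sequence [a0]. *)
have LA : [set: L] #<= [set: {f | A f} * nat].
  have H x : exists y : {f | A f} * nat,
      (exists n, y.2 = n.*2 /\ sval y.1 n = x) \/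
      (~ C x /\ y = (a1, (r x).*2.+1)).
    have [[f [n [Af fn]]]|nCx] := pselect (C x).
      by exists (exist _ f Af, n.*2); left; exists n.
    by exists (a1, (r x).*2.+1); right.
  have [h hP] := choice H.
  apply/card_leTTP; exists h => x y hxy.
  have [[n [hx2 <-]]|[Cx hx]] := hP x; have [[m [hy2 <-]]|[Cy hy]] := hP y.
  - by move: hx2; rewrite hxy hy2 => /double_inj ->.
  - by move: hx2; rewrite hxy hy /= => /(congr1 odd); rewrite /= !odd_double.
  - by move: hy2; rewrite -hxy hx /= => /(congr1 odd); rewrite /= !odd_double.
  - move: hxy; rewrite hx hy => -[] /double_inj.
    by apply: rI; exact: mem_set.
have [h hI] := (card_leTTP _ _).1 LA.
apply/card_leTTP.
exists (fun x => sval (h x.1).1 (choice.pickle ((h x.1).2, x.2))).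
move=> [x m] [y n] /= /PA -/(_ (svalP _) (svalP _)) [hxy1].
move=> /(pcan_inj choice.pickleK) [hxy2 ->]; congr pair; apply: hI.
case: (h x) (h y) hxy1 hxy2 => [[f Af] i] [[g Ag] j] /= fg ->.
by move: Ag; rewrite -fg => Ag; rewrite (Prop_irrelevance Af Ag).
Qed.

Lemma card_le_bigcup_nat {T L : Type} (m : T -> nat) :
  [set: nat] #<= [set: L] ->
  (forall k, [set: {t | m t == k}] #<= [set: L]) -> [set: T] #<= [set: L].
Proof.
move=> Linf mL; apply: card_le_trans (card_mul_nat Linf).
have /all_sig[f fI] k := cid ((card_leTTP _ _).1 (mL k)).
apply/card_leTTP; exists (fun t => (f _ (exist _ t (eqxx (m t))), m t)).
have fI2 k l s t (sk : m s == k) (tl : m t == l) : k = l ->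
    f k (exist _ s sk) = f l (exist _ t tl) -> s = t.
  by move=> kl; subst l => /fI [].
by move=> s t [] /[swap] /fI2; apply.
Qed.

Lemma card_add_nat {A L : Type} : [set: nat] #<= [set: L] ->
  [set: A] #<= [set: L] -> [set: A + nat] #<= [set: L].
Proof.
move=> Linf /card_leTTP[f fI]; apply: card_le_trans (card_mul_nat Linf).
have [g _] := (card_leTTP _ _).1 Linf; apply/card_leTTP.
exists (fun x => match x with inl a => (f a, 0) | inr n => (g 0, n.+1) end).
by move=> [a|n] [b|m] // [] => [/fI|] ->.
Qed.

(** * Boxes in powers *)

Definition box {I : Type} {Z : topologicalType} (V : I -> set Z) :
  set {ptws I -> Z} := [set f | forall i, V i (f i)].

Lemma box_open {I : finType} {Z : topologicalType} (V : I -> set Z) :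
  (forall i, open (V i)) -> open (box V).
Proof.
move=> oV; rewrite openE => f Vf.
pose fV i (g : {ptws I -> Z}) := V i (g i).
suff : \forall g \near f, forall i, fV i g by [].
apply: (@filter_forall _ _ fV _ (nbhs_filter f)) => i.
apply: (@proj_continuous I (fun=> Z) i f (V i)).
exact: open_nbhs_nbhs.
Qed.

(** The sets containing a box around [f] form a filter, and it converges to [f]
    since it does so in each coordinate; so it contains every neighbourhood of
    [f].  For infinite [I] the box itself need not be open. *)
Lemma open_box {I : eqType} {Z : topologicalType} (W : set {ptws I -> Z}) f :
  open W -> W f ->
  exists V : I -> set Z, (forall i, open_nbhs (f i) (V i)) /\ box V `<=` W.
Proof.
move=> oW Wf.
pose F := filter_from [set V : I -> set Z | forall i, open_nbhs (f i) (V i)] box.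
have FF : Filter F.
  apply: filter_from_filter.
    by exists (fun=> setT) => i; split=> //; exact: openT.
  move=> V V' Vf V'f; exists (fun i => V i `&` V' i).
    by move=> i; exact: open_nbhsI.
  by move=> g VVg; split=> i; have [] := VVg i.
have : F --> f.
  apply/cvg_sup => i A; rewrite nbhsE => -[_ [[C oC <-] Cf] CA].
  exists (fun j => if j == i then C else setT).
    by move=> j /=; case: eqP => [->|_]; split=> //; exact: openT.
  by move=> g /(_ i); rewrite eqxx => Cg; exact: CA.
by move=> /(_ _ (open_nbhs_nbhs (conj oW Wf))) [V Vf VW]; exists V.
Qed.

(** * Lower bounds for the two cardinal functions *)

(** The separation of [p] by [N] forces [p] to be injective, so that families
    indexed by [T] may replace weakly separated subsets of [Z]. *)
Lemma card_le_weak_separation_number {T : Type} {Z : topologicalType}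
    (p : T -> Z) (N : T -> set Z) :
  (forall t, open_nbhs (p t) (N t)) ->
  (forall s t, s <> t -> ~ N t (p s) \/ ~ N s (p t)) ->
  [set: T] #<= [set: weak_separation_number Z].
Proof.
move=> Np sep.
have pI : injective p.
  move=> s t pst; apply: contrapT => /sep.
  by rewrite pst -{2}pst; case; apply; case: (Np t); case: (Np s).
have pS (y : range p) : exists t, p t = val y.
  by have [t _ <-] := set_mem (valP y); exists t.
have [q qP] := choice pS.
have ws : weakly_separated (range p : set Z).
  exists (fun y => val @^-1` N (q y)); split=> [y|x y xy].
    have [oN Ny] := Np (q y); split; last by rewrite /= -qP.
    by exists (N (q y)).
  rewrite /= -!qP; apply: sep => qxy; apply: xy.
  by apply: val_inj; rewrite -!qP qxy.
have YK := (card_supP (fun Y : {Y : set Z | weakly_separated Y} =>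
  set_type (sval Y))).1 (exist _ (range p) ws).
have /card_leTTP[g gI] := YK.
apply/card_leTTP.
exists (fun t => inl (g (SigSub (mem_set (imageT p t))))) => s t [] /gI [].
exact: pI.
Qed.

Lemma card_le_cellularity {T : Type} {Z : topologicalType} (O : T -> set Z) :
  (forall t, open (O t)) -> (forall t, O t !=set0) ->
  (forall s t, O s `&` O t !=set0 -> s = t) ->
  [set: T] #<= [set: cellularity Z].
Proof.
move=> oO O0 dis.
have OI : injective O by move=> s t Ost; apply: dis; rewrite Ost setIid.
have cO : cellular (range O).
  split=> [_ [t _ <-]//|_ _ [s _ <-] [t _ <-] st].
  by rewrite (dis s t).
have WK := (card_supP (fun W : {W : set (set Z) | cellular W} =>
  set_type (sval W))).1 (exist _ (range O) cO).
have /card_leTTP[g gI] := WK.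
apply/card_leTTP.
exists (fun t => inl (g (SigSub (mem_set (imageT O t))))) => s t [] /gI [].
exact: OI.
Qed.

Lemma infinite_weak_separation_number (Z : topologicalType) :
  [set: nat] #<= [set: weak_separation_number Z].
Proof. by apply/card_leTTP; exists inr => m n []. Qed.

Lemma infinite_cellularity (Z : topologicalType) :
  [set: nat] #<= [set: cellularity Z].
Proof. by apply/card_leTTP; exists inr => m n []. Qed.

(** Powers indexed by an arbitrary finite nonempty [J] may be used to bound the
    supremum over the exponents; repeating a coordinate is harmless. *)
Lemma card_le_weak_separation_number_star {T : Type} {X : topologicalType}
    {J : finType} (j0 : J) (p : T -> J -> X) (N : T -> J -> set X) :
  (forall t j, open_nbhs (p t j) (N t j)) ->
  (forall s t, (forall j, N t j (p s j) /\ N s j (p t j)) -> s = t) ->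
  [set: T] #<= [set: weak_separation_number_star X].
Proof.
move=> Np sep.
(* The exponent has to be a successor; the surplus index is sent to the
   default [j0]. *)
pose e (i : 'I_#|J|.+1) : J := nth j0 (enum J) i.
have eS j : exists i, e i = j.
  have jJ : index j (enum J) < #|J|.+1.
    by rewrite ltnS cardE index_size.
  by exists (Ordinal jJ); rewrite /e /= nth_index ?mem_enum.
apply: card_le_trans ((card_supP _).1 #|J|).
apply: (card_le_weak_separation_number
  (fun t => p t \o e : {ptws _ -> _}) (fun t => box (N t \o e))) => [t|s t st].
  split; last by move=> i; have [] := Np t (e i).
  by apply: box_open => i; have [] := Np t (e i).
apply: contrapT => /not_orP[/contrapT st1 /contrapT st2]; apply: st.
by apply: sep => j; have [i <-] := eS j; split; [exact: st1|exact: st2].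
Qed.

(** * Basic sets of the Pixley-Roy topology *)

Lemma pr_basic_open {X : topologicalType} (F : {fset X}) (U : set X) :
  F != fset0 -> open U -> open (pr_basic (F, U)).
Proof.
move=> F0 oU; exists [set (F, U)]; first by move=> _ ->.
by rewrite bigcup_set1.
Qed.

(** Raising the lower bound of a basic set around [G] to [G] itself shrinks it to
    another neighbourhood of [G]. *)
Lemma open_pr_basic {X : topologicalType} (W : set (pixley_roy X)) G :
  open W -> W G ->
  exists U, [/\ open U, [set` val G] `<=` U & pr_basic (val G, U) `<=` W].
Proof.
move=> [D sD <-] [[F U] DFU [FG GU]].
exists U; split=> //; first by have [] := sD _ DFU.
move=> H [/= GH HU]; exists (F, U) => //; split=> //=.
exact: fsubset_trans GH.
Qed.

(** The union of the two lower bounds is a common element. *)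
Lemma pr_basic_meet {X : topologicalType} (F F' : {fset X}) (U U' : set X) :
  [set` F] `<=` U `&` U' -> [set` F'] `<=` U `&` U' -> F != fset0 ->
  pr_basic (F, U) `&` pr_basic (F', U') !=set0.
Proof.
move=> FU F'U F0.
have FF'0 : (F `|` F')%fset != fset0.
  by apply: contra F0 => /eqP FF'; rewrite -fsubset0 -FF' fsubsetUl.
exists (exist _ (F `|` F')%fset FF'0).
by split; (split; first by rewrite ?fsubsetUl ?fsubsetUr);
  move=> x /fsetUP[/FU|/F'U] [].
Qed.

(** * Comparison of the two cardinal functions *)

(** A point [x] of [Y] lies in the box chosen for [y] as soon as the products of
    basic sets attached to [x] and [y] share a point [G]: each [G i] then
    contains [x i] and is contained in the [i]-th side of that box. *)
Lemma weak_separation_number_le {X : topologicalType} n :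
  [set: weak_separation_number {ptws 'I_n.+1 -> X}] #<=
  [set: cellularity {ptws 'I_n.+1 -> pixley_roy X}].
Proof.
apply: card_add_nat (infinite_cellularity _) _.
apply: (card_supP _).2 => -[Y [U [Uo Usep]]] /=.
have VS (y : Y) : exists V : 'I_n.+1 -> set X,
    (forall i, open_nbhs (val y i) (V i)) /\
    (forall x : Y, box V (val x) -> U y x).
  have [[W oW WU] Uy] := Uo y.
  have [|V [Vy VW]] := open_box _ (val y) oW; first by rewrite -WU in Uy.
  by exists V; split=> // x Vx; rewrite -WU; exact: VW.
have [V VP] := choice VS.
have F0 (x : X) : [fset x]%fset != fset0 :> {fset X}.
  by apply/fset0Pn; exists x; rewrite inE.
apply: (card_le_cellularity
  (fun y : Y => box (fun i => pr_basic ([fset val y i]%fset, V y i)))).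
- move=> y; apply: box_open => i; apply: pr_basic_open => //.
  by have [] := (VP y).1 i.
- move=> y; exists (fun i => exist (fun F => F != fset0) _ (F0 (val y i))) => i.
  split=> //= x; by rewrite /= inE => /eqP ->; have [] := (VP y).1 i.
- move=> x y [G [Gx Gy]]; apply: contrapT => /Usep.
  case; apply; apply: (VP _).2 => i;
    have [/= xG GV] := Gx i; have [/= yG GV'] := Gy i.
  + by apply: GV'; exact: (fsubsetP xG _ (fset11 _)).
  + by apply: GV; exact: (fsubsetP yG _ (fset11 _)).
Qed.

(** The members of a cellular family are sorted by the largest size of their
    finite sets [G w i], since to list these in one power of [X] takes a common
    exponent. *)
Lemma cellularity_le {X : topologicalType} n :
  [set: cellularity {ptws 'I_n.+1 -> pixley_roy X}] #<=
  [set: weak_separation_number_star X].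
Proof.
have Linf : [set: nat] #<= [set: weak_separation_number_star X].
  exact: card_le_trans (infinite_weak_separation_number _) ((card_supP _).1 0).
apply: (card_add_nat Linf); apply: (card_supP _).2 => -[W [Wo Wdis]] /=.
have BS (w : W) : exists GU : ('I_n.+1 -> pixley_roy X) * ('I_n.+1 -> set X),
    (forall i, open (GU.2 i) /\ [set` val (GU.1 i)] `<=` GU.2 i) /\
    box (fun i => pr_basic (val (GU.1 i), GU.2 i)) `<=` val w.
  have [oW [G WG]] := Wo _ (set_mem (valP w)).
  have [V [VG VW]] := open_box _ G oW WG.
  have US i : exists U, [/\ open U, [set` val (G i)] `<=` U &
      pr_basic (val (G i), U) `<=` V i].
    by have [oV VGi] := VG i; exact: open_pr_basic.
  have [U UP] := choice US.
  exists (G, U); split=> [i|H HGU] /=; first by have [] := UP i.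
  by apply: VW => i; have [_ _] := UP i; apply; exact: HGU.
have [GU GUP] := choice BS.
pose G w i : {fset X} := val ((GU w).1 i).
pose U w := (GU w).2.
have G0 w i : G w i != fset0 by exact: (valP ((GU w).1 i)).
have GsubU w i : [set` G w i] `<=` U w i by have [] := (GUP w).1 i.
have disj v w : (forall i, [set` G v i] `<=` U w i /\ [set` G w i] `<=` U v i) ->
    v = w.
  move=> vw; apply/val_inj/Wdis; [exact: set_mem (valP v)|exact: set_mem (valP w)|].
  have HS i : exists H, (pr_basic (G v i, U v i) `&` pr_basic (G w i, U w i)) H.
    have [vw1 vw2] := vw i.
    by apply: pr_basic_meet => // x xG; split;
      do ?[exact: GsubU|exact: vw1|exact: vw2].
  have [H HP] := choice HS.
  by exists H; split; apply: (GUP _).2 => i; have [] := HP i.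
apply: (card_le_bigcup_nat (fun w : W => \max_i #|` G w i|) Linf) => k.
have G1 (w : W) i : exists x, x \in G w i by exact/fset0Pn.
pose x0 w i := projT1 (cid (G1 w i)).
(* Listing [G w i] past its last element repeats the default point [x0 w i],
   which is chosen in [G w i]. *)
pose p (w : {w : W | \max_i #|` G w i| == k}) (ij : 'I_n.+1 * 'I_k.+1) :=
  nth (x0 (sval w) ij.1) (G (sval w) ij.1) ij.2.
have pG w ij : p w ij \in G (sval w) ij.1.
  rewrite /p; have [ltij|leij] := ltnP ij.2 (size (G (sval w) ij.1)).
    exact: mem_nth.
  by rewrite nth_default //; exact: (projT2 (cid (G1 _ _))).
have pS w i x : x \in G (sval w) i -> exists j, p w (i, j) = x.
  move=> xG; have xk : index x (G (sval w) i) < k.+1.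
    have /eqP wk := svalP w; rewrite ltnS (leq_trans (index_size _ _))//.
    by apply: leq_trans (eq_leq wk); exact: (@leq_bigmax _ (fun i => #|` G _ i|)).
  by exists (Ordinal xk); rewrite /p /= nth_index.
apply: (@card_le_weak_separation_number_star _ X _ (ord0, ord0) p
  (fun w ij => U (sval w) ij.1)) => [w ij|v w vw].
  split; first by have [] := (GUP (sval w)).1 ij.1.
  exact/GsubU/pG.
apply/val_inj/disj => i; split=> x /pS[j <-]; by have [] := vw (i, j).
Qed.

Theorem theorem4p12 (X : topologicalType) (hX : infinite_set [set: X]) :
  [set: weak_separation_number_star X] #= [set: cellularity_star (pixley_roy X)].
Proof.
rewrite card_eq_le; apply/andP; split; apply: (card_supP _).2 => n.
  exact: card_le_trans (weak_separation_number_le n) ((card_supP _).1 n).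
exact: cellularity_le.
Qed.
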